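(* Let $1<r\le2$, let $D>0$, and let $(B,\|\cdot\|)$ be an $(r,D)$-smooth separable Banach space. Let $p_2\ge p_1>r$. Let $(X_i,\mathcal{F}_i)_{i\ge1}$ be a sequence of $B$-valued martingale differences satisfying $$\sup_{i\ge1}\ \sup_{t>0}\ t^{p_1}\,\mathbb{P}\left(\|X_i\|>t\right)\le C_1$$ and $$\sup_{i\ge1}\ \sup_{t>0}\ t^{p_2}\,\mathbb{P}\left(\left(\mathbb{E}\left[\|X_i\|^r\mid\mathcal{F}_{i-1}\right]\right)^{1/r}>t\right)\le C_2$$ for some constants $C_1$ and $C_2$. Put $S_k=\sum_{i=1}^kX_i$. Then, for all $x>0$ and all $n\ge1$, $$\mathbb{P}\left(\max_{1\le k\le n}\|S_k\|>nx\right)\le K_1(p_1,p_2,r,D)\,C_1\,x^{-p_1}\,\frac{1}{n^{p_1-1}}+K_2(p_1,p_2,r,D)\,C_2\,x^{-p_2}\,\frac{1}{n^{p_2-p_2/r}},$$ where $$K_1(p_1,p_2,r,D)=\frac{2^{2p_2}}{2^{2p_2}-1}\,2^{1-r}\,2^{p_1+2p_1p_2/r}\,D^{p_1/r}$$ and $$K_2(p_1,p_2,r,D)=\frac{2^{2p_2}}{2^{2p_2}-1}\,2^{1-r}\,2^{p_2+2p_2^2/r}\,D^{p_2/r}\left(\frac{p_2}{p_2-r}\right)^{p_2/r}$$ do not depend on $n$ or $x$. In particular (with $x=1$), $$\mathbb{P}\left(\max_{1\le k\le n}\|S_k\|>n\right)=O\left(\frac{1}{n^{\min\{p_1-1,\;p_2-p_2/r\}}}\right),\qquad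 n\to\infty.$$
   Context: Let $(\Omega,\mathcal{F},\mathbb{P})$ be a probability space and $(B,\|\cdot\|)$ a separable Banach space. For $p\ge1$, $\mathbb{L}^p_B$ denotes the space of $B$-valued random variables $X$ with $\mathbb{E}[\|X\|^p]<\infty$. Martingale differences: let $(\mathcal{F}_i)_{i\ge1}$ be a non-decreasing sequence of sub-$\sigma$-algebras of $\mathcal{F}$. A sequence $(X_i)_{i\ge1}$ of $B$-valued random variables is a martingale difference sequence with respect to $(\mathcal{F}_i)_{i\ge1}$ (written $(X_i,\mathcal{F}_i)_{i\ge1}$) if (1) for every $i\ge1$, $X_i$ is $\mathcal{F}_i$-measurable and belongs to $\mathbb{L}^1_B$; (2) for every $i\ge2$, $\mathbb{E}[X_i\mid\mathcal{F}_{i-1}]=0$ almost surely. In the conditional expectation $\mathbb{E}[\|X_1\|^r\mid\mathcal{F}_0]$, $\mathcal{F}_0$ denotes a fixed sub-$\sigma$-algebra of $\mathcal{F}_1$. Smoothness: for $1<r\le2$, a Banach space $(B,\|\cdot\|)$ is $r$-smooth if there is an equivalent norm $\|\cdot\|'$ such that $$\sup_{t>0}\frac{1}{t^r}\sup\left\{\|x+ty\|'+\|x-ty\|'-2:\ \|x\|'=\|y\|'=1\right\}<\infty.$$ For $1<r\le 2$ and $D>0$, $B$ is $(r,D)$-smooth if $B$ is $r$-smooth and, for all $B$-valued martingale difference sequences $(X_i)_{i\ge1}$ and all $n\ge1$, $$\mathbb{E}\left\|\sum_{i=1}^nX_i\right\|^r\le D\sum_{i=1}^n\mathbb{E}\|X_i\|^r.$$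 *)

(* Defs.v *)
From HB Require Import structures.
From mathcomp Require Import all_boot all_order all_algebra.
From mathcomp Require Import all_classical all_reals all_analysis.
From mathcomp Require Import measurable_realfun.

Set Implicit Arguments.
Unset Strict Implicit.
Unset Printing Implicit Defensive.

Import Order.TTheory GRing.Theory Num.Theory.
Import numFieldNormedType.Exports.

Local Open Scope classical_set_scope.
Local Open Scope ring_scope.

Definition separable_space (B : topologicalType) : Prop :=
  exists2 A : set B, countable A & dense A.

Definition borel (B : topologicalType) : set (set B) := <<s open >>.

Definition sigma_subalgebra d (T : measurableType d) (G : set (set T)) : Prop :=
  sigma_algebra setT G /\ G `<=` measurable.

(* Random variables with values in B.  As B is separable, Borel measurability
   coincides with strong measurability. *)
Section banach_valued.
Context d (T : measurableType d) (R : realType) (P : probability T R).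
Context (B : completeNormedModType R).
Implicit Types (G : set (set T)) (X Y s : T -> B) (v : B).

Definition measurable_wrt G X : Prop :=
  forall A : set B, borel A -> G (X @^-1` A).

Definition in_L1 X : Prop :=
  measurable_wrt measurable X /\ ('E_P[fun w => `|X w|%R] < +oo)%E.

Definition simple_rv s : Prop :=
  finite_set (range s) /\ forall v, measurable (s @^-1` [set v]).

Definition simple_integral s : B :=
  \sum_(v \in range s) fine (P (s @^-1` [set v])) *: v.

(* [is_bochner_integral X v]: X is Bochner integrable with integral v. *)
Definition is_bochner_integral X v : Prop :=
  measurable_wrt measurable X /\
  exists s : nat -> T -> B,
    [/\ forall m, simple_rv (s m),
        'E_P[fun w => `|X w - s m w|%R]%E @[m --> \oo] --> 0%E &
        simple_integral (s m) @[m --> \oo] --> v].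

(* [is_condexp G X Y]: Y is a version of the conditional expectation E[X | G]. *)
Definition is_condexp G X Y : Prop :=
  [/\ in_L1 X, in_L1 Y, measurable_wrt G Y &
      forall A, G A -> exists v,
        is_bochner_integral (fun w => \1_A w *: X w) v /\
        is_bochner_integral (fun w => \1_A w *: Y w) v].

(* Sequences are indexed from 1: F 0 and X 0 are irrelevant here. *)
Definition martingale_difference (F : nat -> set (set T)) (X : nat -> T -> B)
    : Prop :=
  [/\ forall i, (1 <= i)%N -> sigma_subalgebra (F i),
      forall i j, (1 <= i)%N -> (i <= j)%N -> F i `<=` F j,
      forall i, (1 <= i)%N -> measurable_wrt (F i) (X i) /\ in_L1 (X i) &
      forall i, (2 <= i)%N -> is_condexp (F i.-1) (X i) (cst 0)].

End banach_valued.

(* Conditional expectation of a random variable with values in [0, +oo];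
   no integrability is needed. *)
Definition is_condexp_ge0 d (T : measurableType d) (R : realType)
    (P : probability T R) (G : set (set T)) (Z V : T -> \bar R) : Prop :=
  [/\ forall w, (0 <= V w)%E,
      forall A, measurable A -> G (V @^-1` A) &
      forall A, G A -> (\int[P]_(w in A) V w = \int[P]_(w in A) Z w)%E].

Section smoothness.
Context (R : realType) (B : completeNormedModType R).

Definition equivalent_norm (N : B -> R) : Prop :=
  [/\ forall x y, N (x + y) <= N x + N y,
      forall (a : R) x, N (a *: x) = `|a| * N x &
      exists c C : R, [/\ 0 < c, 0 < C &
        forall x, c * `|x| <= N x /\ N x <= C * `|x|]].

Definition smoothness_modulus (N : B -> R) (t : R) : \bar R :=
  ereal_sup [set (N (z.1 + t *: z.2) + N (z.1 - t *: z.2) - 2)%:E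
            | z in [set z : B * B | N z.1 = 1 /\ N z.2 = 1]].

Definition smooth (r : R) : Prop :=
  exists2 N : B -> R, equivalent_norm N &
    (ereal_sup [set ((t `^ r)^-1)%:E * smoothness_modulus N t
               | t in [set t : R | (0 < t)%R]] < +oo)%E.

(* The martingales are those on the ambient probability space. *)
Definition D_smooth d (T : measurableType d) (P : probability T R) (r D : R)
    : Prop :=
  smooth r /\
  forall (F : nat -> set (set T)) (X : nat -> T -> B),
    martingale_difference P F X ->
    forall n, (1 <= n)%N ->
    ('E_P[fun w => (`|\sum_(1 <= i < n.+1) X i w| `^ r)%R]
      <= D%:E * \sum_(1 <= i < n.+1) 'E_P[fun w => (`|X i w| `^ r)%R])%E.

End smoothness.

(* sup_(t > 0) t^p P(Z > t) *)
Definition weak_moment d (T : measurableType d) (R : realType)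
    (P : probability T R) (p : R) (Z : T -> \bar R) : \bar R :=
  ereal_sup [set ((t `^ p)%:E * P [set w | (t%:E < Z w)%E])%E
            | t in [set t : R | 0 < t]].

Definition partial_sum (R : realType) (B : completeNormedModType R) (T : Type)
    (X : nat -> T -> B) (k : nat) (w : T) : B := \sum_(1 <= i < k.+1) X i w.

(* max_(1 <= k <= n) ||S_k||; the default value 0 is harmless for n >= 1 since
   norms are nonnegative. *)
Definition max_partial_sum (R : realType) (B : completeNormedModType R)
    (T : Type) (X : nat -> T -> B) (n : nat) (w : T) : R :=
  \big[Num.max/0]_(1 <= k < n.+1) `|partial_sum X k w|.

Definition K1 (R : realType) (p1 p2 r D : R) : R :=
  2 `^ (2 * p2) / (2 `^ (2 * p2) - 1) * 2 `^ (1 - r)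
  * 2 `^ (p1 + 2 * p1 * p2 / r) * D `^ (p1 / r).

Definition K2 (R : realType) (p1 p2 r D : R) : R :=
  2 `^ (2 * p2) / (2 `^ (2 * p2) - 1) * 2 `^ (1 - r)
  * 2 `^ (p2 + 2 * p2 ^+ 2 / r) * D `^ (p2 / r)
  * (p2 / (p2 - r)) `^ (p2 / r).

(* Main.v *)
Require Import Defs.
From HB Require Import structures.
From mathcomp Require Import all_boot all_order all_algebra.
From mathcomp Require Import all_classical all_reals all_analysis.
From mathcomp Require Import measurable_realfun.
From mathcomp Require Import ring lra.

(** Good-lambda argument with an integral in place of the usual event on the
    conditional moments. Let S* be the maximal norm, G = {S* > y/4}, and let Z
    be the transform of X by the predictable window between the first times
    |S_k| exceeds y/4 and y. If all |X_i| <= y/2, then S* > y forces |Z| > y/4,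
    so Markov's inequality and smoothness give
      P(S* > y) <= D (y/4)^-r sum_i int_G E[|X_i|^r | F_(i-1)]
                     + sum_i P(|X_i| > y/2).
    With q = p2/r > 1, the weak moment of order q of each conditional moment
    bounds its integral over G by a P(G) + C2 a^(1-q) / (q-1) for every a > 0.
    Choosing a so that P(G) gets the coefficient (1 - 1/q) 4^-p2 yields
    f(y) <= (1 - 1/q) 4^-p2 f(y/4) + h(y) for f(y) = P(S* > y), and since
    h(y/4) <= 4^p2 h(y), iterating gives f <= q h, which is below the stated
    bound. *)

Set Implicit Arguments.
Unset Strict Implicit.
Unset Printing Implicit Defensive.

Import Order.TTheory GRing.Theory Num.Theory.
Import numFieldNormedType.Exports.

Local Open Scope classical_set_scope.
Local Open Scope ring_scope.

(** * Integrals over an event from tail bounds *)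

(** Layer-cake with the levels below [a] kept apart: [V] is at most [a] plus the length of the set
    of [s >= a] with [s < V]. On [G] the first part integrates to [a P(G)]; in the second, [G] is
    enlarged to the whole space and Tonelli exchanges the integrals. *)
Lemma integral_le_tail d (T : measurableType d) (R : realType)
    (P : probability T R) (V : T -> \bar R) (G : set T) (a : R)
    (g : R -> \bar R) :
  measurable_fun setT V -> (forall w, 0 <= V w)%E -> measurable G -> 0 <= a ->
  measurable_fun `[a, +oo[ g ->
  (forall s, (a <= s)%R -> P [set w | (s%:E < V w)%E] <= g s)%E ->
  (\int[P]_(w in G) V w <=
   a%:E * P G + \int[lebesgue_measure]_(s in `[a, +oo[) g s)%E.
Proof.
move=> mV V0 mG a0 mg Vg.
(* The region between level [a] and the graph of [V]; its sections in [s] are the lengths above, and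
   its sections in [w] are the tail events. *)
pose A : set (T * measurableTypeR R) := [set z | a <= z.2 /\ (z.2%:E < V z.1)%E].
have mA : measurable A.
  have -> : A = (setT `&` [set z : T * measurableTypeR R | a%:E <= z.2%:E]%E) `&`
      (setT `&` [set z : T * measurableTypeR R | z.2%:E < V z.1]%E).
    apply/seteqP; split=> z /=; rewrite lee_fin.
      by move=> [].
    by move=> [[_ ?] [_ ?]].
  apply: measurableI.
    apply: measurable_lee => //.
    by apply/measurable_EFinP; exact: measurable_snd.
  apply: measurable_lte => //.
    by apply/measurable_EFinP; exact: measurable_snd.
  by apply: measurableT_comp => //; exact: measurable_fst.
pose mu := @lebesgue_measure R.
pose h w := mu (xsection A w).
have mh : measurable_fun setT h by exact: measurable_fun_xsection.
have Vh w : (V w <= a%:E + h w)%E.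
  have -> : h w = mu [set s : R | a <= s /\ (s%:E < V w)%E].
    by rewrite /h; congr (mu _); apply/seteqP; split=> s; rewrite /xsection /= in_setE.
  case: (V w) (V0 w) => [v| |] // _.
    have -> : [set s : R | a <= s /\ (s%:E < v%:E)%E] = `[a, v[%classic.
      by apply/seteqP; split=> s /=; rewrite in_itv/= lte_fin => /andP.
    rewrite /mu lebesgue_measure_itv/= lte_fin; case: ltP => [av|va].
      by rewrite -EFinB -EFinD lee_fin addrC subrK.
    by rewrite adde0 lee_fin.
  have -> : [set s : R | a <= s /\ (s%:E < +oo)%E] = `[a, +oo[%classic.
    by apply/seteqP; split=> s /=; rewrite in_itv/= andbT ?ltry// => -[].
  by rewrite /mu lebesgue_measure_itv/= ltry.
apply: (@le_trans _ _ (\int[P]_(w in G) (a%:E + h w))%E).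
  apply: ge0_le_integral => //.
  - exact: measurable_funTS.
  by apply: emeasurable_funD => //; exact: measurable_funTS.
rewrite ge0_integralD//; last by exact: measurable_funTS.
rewrite integral_cst//; apply: leeD => //.
apply: (@le_trans _ _ (\int[P]_w h w)%E).
  by apply: ge0_subset_integral.
have := indic_fubini_tonelli P
  (mu : {sigma_finite_measure set (measurableTypeR R) -> \bar R}) mA.
rewrite indic_fubini_tonelli_FE// indic_fubini_tonelli_GE//= => ->.
have g0 s : a <= s -> (0 <= g s)%E by move=> /Vg; apply: le_trans.
rewrite [leRHS]integral_mkcond; apply: ge0_le_integral => //.
- exact: measurable_fun_ysection.
- by apply/(measurable_restrictT _ _).1.
move=> s _ /=; rewrite patchE; case: ifPn.
  rewrite in_setE /= in_itv/= andbT => as_; apply: le_trans (Vg _ as_).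
  apply: le_measure; rewrite ?inE.
  - exact: measurable_ysection.
  - by rewrite -[X in measurable X]setTI; exact: emeasurable_fun_o_infty.
  - by move=> w; rewrite /ysection/= in_setE => -[].
move=> as_; rewrite (_ : ysection A s = set0) ?measure0//.
apply/seteqP; split=> w //; rewrite /ysection/= in_setE => -[/= sa _].
by move: as_; rewrite notin_setE/= in_itv/= sa.
Qed.

(** The antiderivative [- s^(1-q) / (q-1)] vanishes at infinity because [q > 1]. *)
Lemma integral_powR_tail (R : realType) (q a : R) : 1 < q -> 0 < a ->
  (\int[lebesgue_measure]_(s in `[a, +oo[) (s `^ (- q))%:E =
   (a `^ (1 - q) / (q - 1))%:E)%E.
Proof.
move=> q1 a0.
have q0 : q - 1 != 0 by rewrite subr_eq0 gt_eqF.
have cpow (p x : R) : 0 < x -> {for x, continuous (fun s : R => s `^ p)}.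
  move=> x0; apply: differentiable_continuous.
  by apply/derivable1_diffP; apply: derivable_powR; rewrite in_itv/= x0.
rewrite (@ge0_continuous_FTC2y _ _ (fun s => - (s `^ (1 - q) / (q - 1))) _ 0)//.
- by rewrite sub0e -EFinN opprK.
- by move=> x _; exact: powR_ge0.
- apply/continuous_within_itvcyP; split.
    move=> x; rewrite in_itv/= andbT => ax; apply: cpow.
    exact: lt_trans ax.
  by apply: cvg_at_right_filter; exact: cpow.
- rewrite -oppr0; apply: cvgN; rewrite -(mul0r (q - 1)^-1); apply: cvgMl.
  rewrite (_ : (fun s => _) = fun s => (s `^ (q - 1))^-1); last first.
    by apply/funext => s; rewrite -powRN opprB.
  apply/gtr0_cvgV0.
    by near=> s; rewrite powR_gt0//; near: s; exact: nbhs_pinfty_gt.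
  apply/cvgryPge => A; near=> s.
  have A0 : 0 <= Num.max A 0 by rewrite le_max lexx orbT.
  rewrite (@le_trans _ _ (Num.max A 0))// ?le_max ?lexx//.
  (* The nonnegative bound is written as the power [q - 1] of its own root of that order, so it
     suffices that [s] exceeds this root. *)
  rewrite -[leLHS](@powRr1 _)// -[X in _ `^ X](mulVf q0) powRrM.
  apply: ge0_ler_powR; rewrite ?nnegrE ?powR_ge0 ?subr_ge0 ?ltW//.
- move=> x ax; have x0 := lt_trans a0 ax.
  by apply: derivableN; apply: derivableM => //; apply: derivable_powR;
    rewrite in_itv/= x0.
- apply: cvg_at_right_filter.
  by apply: cvgN; apply: cvgMl; exact: cpow.
- move=> x; rewrite in_itv/= andbT => ax; have x0 := lt_trans a0 ax.
  have dp : is_derive x 1 (fun s : R => s `^ (1 - q)) ((1 - q) * x `^ (1 - q - 1)).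
    exact: is_derive1_powR.
  rewrite derive1E deriveN// deriveM// derive_cst scaler0 add0r derive_val.
  rewrite /GRing.scale/= addrAC subrr add0r -[1 - q]opprB.
  by field.
Unshelve. all: by end_near.
Qed.

(** Only the first term carries [P G]. Since [a] stays free, the coefficient of [P G] can later be
    made as small as desired, at the price of the second term. *)
Lemma integral_weak_moment_le d (T : measurableType d) (R : realType)
    (P : probability T R) (V : T -> \bar R) (G : set T) (q C a : R) :
  measurable_fun setT V -> (forall w, 0 <= V w)%E -> measurable G ->
  1 < q -> 0 < a ->
  (forall s, (0 < s)%R -> P [set w | (s%:E < V w)%E] <= (C * s `^ (- q))%:E)%E ->
  (\int[P]_(w in G) V w <= a%:E * P G + (C * (a `^ (1 - q) / (q - 1)))%:E)%E.
Proof.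
move=> mV V0 mG q1 a0 VC.
have C0 : 0 <= C.
  have := le_trans (measure_ge0 P _) (VC _ ltr01).
  by rewrite powR1 mulr1 lee_fin.
have mp : measurable_fun `[a, +oo[%classic (fun s : R => s `^ (- q)).
  by apply: measurable_funTS; exact: measurable_powR.
apply: le_trans (@integral_le_tail _ _ _ _ _ _ _
  (fun s => (C * s `^ (- q))%:E) _ _ _ (ltW a0) _ _) _ => //.
- by apply/measurable_EFinP; apply: measurable_funM.
- by move=> s as_; apply: VC; exact: lt_le_trans as_.
rewrite leeD2l//; under eq_integral do rewrite EFinM.
rewrite ge0_integralZl//; last first.
- by move=> s _; rewrite lee_fin powR_ge0.
- by apply/measurable_EFinP.
by rewrite integral_powR_tail// EFinM.
Qed.

(** * Borel measurability in a separable Banach space *)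

Lemma separable_space_seq (R : realType) (B : completeNormedModType R) :
  separable_space B ->
  exists a : nat -> B, forall x (e : R), 0 < e -> exists n, `|x - a n| < e.
Proof.
move=> [A cA dA].
have dA' x (e : R) : 0 < e -> exists2 b, A b & `|x - b| < e.
  move=> e0; have [] := dA (ball x e).
  - by exists x; exact: ballxx.
  - exact: ball_open.
  by move=> b [xb Ab]; exists b => //; move: xb; rewrite -ball_normE.
have [b0 Ab0 _] := dA' 0 1 ltr01.
have /pfcard_geP[A0|[f]] : (A #<= [set: nat])%card by [].
  by move: Ab0; rewrite A0.
exists f => x e /(dA' x)[b Ab xb].
by have [n _ fn] := 'surj_f Ab; exists n; rewrite fn.
Qed.

Section measurable_wrt.
Context (R : realType) (B : completeNormedModType R).
Context d (T : measurableType d) (G : set (set T)).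
Hypothesis sG : sigma_algebra setT G.

(** Gives access, for a bare family of sets [G], to the closure rules stated for measurable sets. *)
Let GE : G.-sigma.-measurable = G := measurable_g_measurableTypeE sG.

Lemma measurable_wrt_open (X : T -> B) :
  (forall U, open U -> G (X @^-1` U)) -> measurable_wrt G X.
Proof.
move=> GX; rewrite /measurable_wrt /borel.
apply: (@smallest_sub _ _ _ [set A | G (X @^-1` A)]) => //.
case: sG => G0 GC GU; split => /=; first by rewrite preimage_set0.
- by move=> A /GC; rewrite !setTD.
- by move=> A GA; rewrite preimage_bigcup; exact: GU.
Qed.

Lemma measurable_wrt_preimage (X : T -> B) (U : set B) :
  open U -> measurable_wrt G X -> G (X @^-1` U).
Proof. by move=> oU; apply; exact: sub_sigma_algebra. Qed.

Lemma measurable_wrt_norm (X : T -> B) (c : R) :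
  measurable_wrt G X -> G [set w | c < `|X w|].
Proof.
move=> GX; rewrite (_ : [set _ | _] = X @^-1` [set b | c < `|b|])//.
apply: measurable_wrt_preimage => //.
apply: (@open_comp _ _ (fun b : B => `|b|) [set s : R | c < s]).
  by move=> b _; exact: norm_continuous.
exact: open_gt.
Qed.

Lemma measurable_wrt_cst (b : B) : measurable_wrt G (cst b).
Proof.
move=> A _; rewrite preimage_cst -GE; case: ifP => _.
exact: measurableT.
exact: measurable0.
Qed.

(** Separability makes the preimage of an open [U] under the sum a countable union of boxes: pairs
    of balls of radius [1/(k+1)] about points of the dense sequence, kept only if all sums of their
    points lie in [U]. *)
Lemma measurable_wrtD (X Y : T -> B) : separable_space B ->
  measurable_wrt G X -> measurable_wrt G Y ->
  measurable_wrt G (fun w => X w + Y w).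
Proof.
move=> /separable_space_seq[a da] GX GY; apply: measurable_wrt_open => U oU.
pose near_ (b : B) k : set B := ball b (k.+1%:R^-1 : R).
pose fits (i : nat * nat * nat) := forall u v,
  near_ (a i.1.1) i.2 u -> near_ (a i.1.2) i.2 v -> U (u + v).
pose box (i : nat * nat * nat) := if `[<fits i>] then
  X @^-1` near_ (a i.1.1) i.2 `&` Y @^-1` near_ (a i.1.2) i.2 else set0.
rewrite (_ : _ @^-1` U = \bigcup_i box i); last first.
  apply/seteqP; split=> w; last first.
    by move=> [i _]; rewrite /box; case: asboolP => // Ui [Xw Yw]; exact: Ui.
  rewrite /preimage/= => UXY.
  have /nbhs_ballP[e /= e0 eU] : nbhs (X w + Y w) U by exact: open_nbhs_nbhs.
  (* Four distances below [h] add up in the estimate: [X w] and [Y w] to the two centres, and the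
     centres to [u] and [v]. *)
  pose k := Num.trunc (4 / e); pose h : R := k.+1%:R^-1.
  have h0 : 0 < h by rewrite invr_gt0.
  have he : 4 * h < e.
    rewrite /h ltr_pdivrMr// mulrC -ltr_pdivrMr//.
    exact: truncnS_gt.
  have [m hm] := da (X w) _ h0; have [n hn] := da (Y w) _ h0.
  exists ((m, n), k) => //; rewrite /box; case: asboolP => [_|[]].
    by split; rewrite /near_ /= -ball_normE /= distrC.
  move=> u v; rewrite /near_ /= -!ball_normE /= -/h => hu hv.
  apply: eU; rewrite -ball_normE /=.
  have -> : X w + Y w - (u + v) =
      (X w - a m) + (Y w - a n) + ((a m - u) + (a n - v)).
    by rewrite [RHS]addrACA !subrKA opprD addrACA.
  have := ler_normD ((X w - a m) + (Y w - a n)) ((a m - u) + (a n - v)).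
  have := ler_normD (X w - a m) (Y w - a n).
  have := ler_normD (a m - u) (a n - v).
  lra.
rewrite -GE; apply: countable_bigcupT_measurable => [//|i].
rewrite /box; case: asboolP => _; last exact: measurable0.
by apply: measurableI; rewrite GE; apply: measurable_wrt_preimage => //; exact: ball_open.
Qed.

End measurable_wrt.
Lemma measurable_wrt_sub (R : realType) (B : completeNormedModType R)
    d (T : measurableType d) (G H : set (set T)) (X : T -> B) :
  G `<=` H -> measurable_wrt G X -> measurable_wrt H X.
Proof. by move=> GH GX A /GX/GH. Qed.

Lemma measurable_normr_wrt (R : realType) (B : completeNormedModType R)
    d (T : measurableType d) (X : T -> B) :
  measurable_wrt measurable X -> measurable_fun setT (fun w => `|X w|).
Proof.
move=> mX; apply: (measurability _ (RGenOInfty.measurableE R)) => // _ [_ [c ->] <-].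
rewrite setTI (_ : _ @^-1` _ = [set w | c < `|X w|]); last first.
  by apply/seteqP; split=> w; rewrite /= in_itv/= andbT.
by apply: measurable_wrt_norm => //; exact: sigma_algebra_measurable.
Qed.

(** Off [A] the product is 0, so the complement of [A] belongs to the preimage of [U] exactly when
    [U] contains 0. *)
Lemma measurable_wrt_indicZ (R : realType) (B : completeNormedModType R)
    d (T : measurableType d) (G : set (set T)) (A : set T) (X : T -> B) :
  sigma_algebra setT G -> G A -> measurable_wrt G X ->
  measurable_wrt G (fun w => \1_A w *: X w).
Proof.
move=> sG GA GX U bU.
rewrite (_ : _ @^-1` U =
    (A `&` X @^-1` U) `|` (~` A `&` [set _ | U 0])); last first.
  apply/seteqP; split=> w /=; rewrite indicE.
    by have [/set_mem Aw|/negP Aw] := boolP (w \in A); rewrite ?scale1r ?scale0r => Uw;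
      [left|right; split => // /mem_set].
  move=> [[Aw]|[Aw]]; first by rewrite mem_set// scale1r.
  by rewrite memNset// scale0r.
have := GA; have := GX _ bU; rewrite -(measurable_g_measurableTypeE sG) => GU GA'.
apply: measurableU; apply: measurableI => //; first exact: measurableC.
have [U0|U0] := pselect (U 0).
  by rewrite (_ : [set _ | _] = setT)//; apply/seteqP; split.
by rewrite (_ : [set _ | _] = set0)//; apply/seteqP; split.
Qed.

(** * Transforms by predictable indicators *)

Section martingale_transform.
Context (R : realType) (d : measure_display) (T : measurableType d).
Context (P : probability T R) (B : completeNormedModType R).

Lemma in_L1_cst0 : in_L1 P (cst 0 : T -> B).
Proof.
split; first by apply: measurable_wrt_cst; exact: sigma_algebra_measurable.
rewrite (_ : (fun w => `|(cst 0 : T -> B) w|) = cst 0) ?expectation_cst ?ltry//.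
by apply/funext => w; rewrite normr0.
Qed.

Lemma in_L1_indicZ (A : set T) (X : T -> B) : measurable A ->
  in_L1 P X -> in_L1 P (fun w => \1_A w *: X w).
Proof.
move=> mA [mX X1].
have mY : measurable_wrt measurable (fun w => \1_A w *: X w).
  by apply: measurable_wrt_indicZ => //; exact: sigma_algebra_measurable.
split => //; apply: le_lt_trans X1; apply: expectation_le.
- exact: measurable_normr_wrt.
- exact: measurable_normr_wrt.
- by move=> w.
- by move=> w.
- apply: aeW => w; rewrite normrZ indicE.
  by case: (_ \in _); rewrite ?normr1 ?mul1r// normr0 mul0r.
Qed.

(** Testing the new difference on [G] in [F i.-1] amounts to testing [X i] on the intersection of
    [G] and [A i], which is again in [F i.-1]. At index 1 there is no centering to preserve, so
    membership of [A 1] in [F 1] suffices. *)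
Lemma martingale_difference_transform (F : nat -> set (set T))
    (X : nat -> T -> B) (A : nat -> set T) :
  martingale_difference P F X ->
  F 1%N (A 1%N) -> (forall i, (2 <= i)%N -> F i.-1 (A i)) ->
  martingale_difference P F (fun i w => \1_(A i) w *: X i w).
Proof.
move=> [sF FF FX X0] FA1 FA.
have FAi i : (1 <= i)%N -> F i (A i).
  case: i => [|[|i]]// _; apply: (FF i.+1 i.+2) => //; exact: (FA i.+2).
split => //.
  move=> i i1; have [FXi Xi1] := FX i i1; have [sFi Fm] := sF i i1; split.
    by apply: measurable_wrt_indicZ => //; exact: FAi.
  by apply: in_L1_indicZ => //; exact/Fm/FAi.
move=> i i2; have [Xi1 _ _ H] := X0 i i2.
have i1 : (1 <= i.-1)%N by case: i i2 {Xi1 H} => [|[]].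
have [sFi Fm] := sF i.-1 i1; split.
- by apply: in_L1_indicZ => //; exact/Fm/FA.
- exact: in_L1_cst0.
- exact: measurable_wrt_cst.
move=> G FG.
have FAG : F i.-1 (G `&` A i).
  by have := FA i i2; move: FG; rewrite -(measurable_g_measurableTypeE sFi) => *;
    exact: measurableI.
have [v [Hv H0]] := H _ FAG; exists v; split.
  rewrite (_ : (fun w => \1_G w *: (\1_(A i) w *: X i w)) =
      fun w => \1_(G `&` A i) w *: X i w)//.
  by apply/funext => w; rewrite indicI /= scalerA.
rewrite (_ : (fun w => \1_G w *: cst 0 w) =
    fun w => \1_(G `&` A i) w *: cst 0 w)//.
by apply/funext => w; rewrite /= !scaler0.
Qed.

End martingale_transform.

(** * Pathwise analysis of the stopped window *)

Section stopped_window.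
Context (R : realType) (B : completeNormedModType R) (T : Type).
Variable X : nat -> T -> B.

(** The index [k] starts at 0, where the partial sum is 0; for [c >= 0] this adds nothing. *)
Definition exceeds (m : nat) (c : R) : set T :=
  [set w | exists2 k, (k <= m)%N & c < `|partial_sum X k w|].

(* [window y i] says that i lies in ]mu, nu], where mu and nu are the first
   times k at which the norm of the partial sum exceeds y / 4 and y. *)
Definition window (y : R) (i : nat) : set T :=
  exceeds i.-1 (y / 4) `\` exceeds i.-1 y.

Lemma partial_sum0 w : partial_sum X 0 w = 0.
Proof. by rewrite /partial_sum big_nil. Qed.

Lemma partial_sumS k w : partial_sum X k.+1 w = partial_sum X k w + X k.+1 w.
Proof. by rewrite /partial_sum big_nat_recr. Qed.

Lemma window1 y : 0 < y -> window y 1 = set0.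
Proof.
move=> y0; apply/seteqP; split=> w // [[k]]/=; rewrite leqn0 => /eqP -> + _.
rewrite partial_sum0 normr0; lra.
Qed.

Lemma exceedsE (m : nat) (c : R) w :
  exceeds m.+1 c w <-> exceeds m c w \/ c < `|partial_sum X m.+1 w|.
Proof.
split=> [[k]|[[k km ck]|cm]]; last by exists m.+1.
  by rewrite leq_eqVlt => /orP[/eqP -> ?|km ck]; [right|left; exists k].
by exists k => //; exact: leqW.
Qed.

Lemma max_partial_sum_gt (n : nat) (c : R) : 0 <= c ->
  [set w | c < max_partial_sum X n w] = exceeds n c.
Proof.
move=> c0; apply/seteqP; split=> w /=.
  apply: contraPP => nE; apply/negP; rewrite -leNgt.
  rewrite /max_partial_sum big_nat_cond; apply: bigmax_le => // k.
  rewrite andbT ltnS => /andP[_ kn]; rewrite leNgt; apply/negP => ck.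
  by apply: nE; exists k.
move=> [[|k] kn ck]; first by move: ck; rewrite partial_sum0 normr0 ltNge c0.
apply: lt_le_trans ck _; rewrite /max_partial_sum.
apply: (@le_bigmax_seq _ _ _ _ _ k.+1 xpredT (fun k => `|partial_sum X k w|)) => //.
by rewrite mem_index_iota ltnS.
Qed.

(** With increments at most [y/2], the sum at mu is at most [y/4 + y/2 = 3y/4], while at nu it
    exceeds [y]. The windowed sum at nu is the difference of the two, hence larger than [y/4] in
    norm, and it stays constant afterwards. *)
Lemma windowed_sum_gt (n : nat) (y : R) (w : T) : 0 < y ->
  (forall i, (1 <= i <= n)%N -> `|X i w| <= y / 2) -> exceeds n y w ->
  y / 4 < `|\sum_(1 <= i < n.+1) \1_(window y i) w *: X i w|.
Proof.
move=> y0 Xy.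
pose S m := partial_sum X m w.
pose Z m := \sum_(1 <= i < m.+1) \1_(window y i) w *: X i w.
have ZS m : Z m.+1 = Z m + \1_(window y m.+1) w *: X m.+1 w.
  by rewrite /Z big_nat_recr.
have mono m : exceeds m y w -> exceeds m (y / 4) w.
  by move=> [k km yk]; exists k => //; lra.
(* The three stages: before mu, from mu until just before nu, from nu on. *)
suff H m : (m <= n)%N ->
    [\/ ~ exceeds m (y / 4) w /\ Z m = 0,
        [/\ exceeds m (y / 4) w, ~ exceeds m y w & `|S m - Z m| <= 3 * y / 4] |
        exceeds m y w /\ y / 4 < `|Z m|].
  by move=> Ey; case: (H n (leqnn n)) => [[/(_ (mono _ Ey))]|[_ /(_ Ey)]|[]].
elim: m => [_|m IH mn].
  apply: Or31; split; last by rewrite /Z big_nil.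
  by move=> [k]; rewrite leqn0 => /eqP ->; rewrite partial_sum0 normr0; lra.
have Xm : `|X m.+1 w| <= y / 2 by apply: Xy.
have SS : S m.+1 = S m + X m.+1 w by exact: partial_sumS.
have hS := ler_normD (S m) (X m.+1 w); rewrite -SS in hS.
case: (IH (ltnW mn)) => [[nE Z0]|[E nEy SZ]|[Ey Zy]].
(* Before mu the weight is 0. A step that crosses [y/4] lands at norm at most [3y/4], so it cannot
   cross [y] at the same time. *)
- have Z0' : Z m.+1 = 0.
    by rewrite ZS Z0 indicE memNset ?scale0r ?addr0// => -[].
  have Sm : `|S m| <= y / 4.
    by rewrite leNgt; apply/negP => ?; apply: nE; exists m.
  have [E'|E'] := pselect (exceeds m.+1 (y / 4) w); last exact: Or31.
  apply: Or32; split => //.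
    move=> /exceedsE[/mono//|]; rewrite -/(S _); lra.
  rewrite Z0' subr0; lra.
(* Inside the window the weight is 1, so [S - Z] stays frozen at the sum at mu. *)
- have ZX : Z m.+1 = Z m + X m.+1 w by rewrite ZS indicE mem_set// scale1r.
  have SZ' : S m.+1 - Z m.+1 = S m - Z m by rewrite SS ZX opprD addrACA subrr addr0.
  have [E'|E'] := pselect (exceeds m.+1 y w).
    apply: Or33; split => //; case/exceedsE : E' => [//|]; rewrite -/(S _) => Sy.
    have := ler_normD (S m.+1 - Z m.+1) (Z m.+1); rewrite subrK SZ'; lra.
  apply: Or32; split => //; first by apply/exceedsE; left.
  by rewrite SZ'.
- apply: Or33; split; first by apply/exceedsE; left.
  by rewrite ZS indicE memNset ?scale0r ?addr0// => -[].
Qed.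

End stopped_window.

(** * Measurability of the exceedance events *)

Section exceeds_measurable.
Context (R : realType) (B : completeNormedModType R).
Context d (T : measurableType d) (G : set (set T)) (X : nat -> T -> B).
Hypotheses (sG : sigma_algebra setT G) (sepB : separable_space B).

Lemma measurable_wrt_partial_sum n :
  (forall i, (1 <= i <= n)%N -> measurable_wrt G (X i)) ->
  measurable_wrt G (partial_sum X n).
Proof.
elim: n => [_|n IH GX].
  rewrite (_ : partial_sum X 0 = cst 0); first exact: measurable_wrt_cst.
  by apply/funext => w; rewrite partial_sum0.
rewrite (_ : partial_sum X n.+1 = fun w => partial_sum X n w + X n.+1 w).
  apply: measurable_wrtD => //; last by apply: GX; rewrite leqnn.
  by apply: IH => i /andP[i1 ni]; apply: GX; rewrite i1 leqW.
by apply/funext => w; rewrite partial_sumS.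
Qed.

Lemma exceeds_measurable n c :
  (forall i, (1 <= i <= n)%N -> measurable_wrt G (X i)) -> G (exceeds X n c).
Proof.
elim: n => [|n IH] GX.
  rewrite (_ : exceeds X 0 c = [set w | c < `|partial_sum X 0 w|]).
    by apply: measurable_wrt_norm => //; apply: measurable_wrt_partial_sum.
  apply/seteqP; split=> w /= => [[k]|]; last by exists 0%N.
  by rewrite leqn0 => /eqP ->.
rewrite (_ : exceeds X n.+1 c =
    exceeds X n c `|` [set w | c < `|partial_sum X n.+1 w|]); last first.
  by apply/seteqP; split=> w /exceedsE.
have GE' : G (exceeds X n c).
  by apply: IH => i /andP[i1 ni]; apply: GX; rewrite i1 leqW.
have GN : G [set w | c < `|partial_sum X n.+1 w|].
  by apply: measurable_wrt_norm => //; apply: measurable_wrt_partial_sum.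
by move: GE' GN; rewrite -(measurable_g_measurableTypeE sG); exact: measurableU.
Qed.

End exceeds_measurable.

(** * Markov's inequality, weak moments and conditional moments *)

Section moments.
Context (R : realType) (d : measure_display) (T : measurableType d).
Context (P : probability T R) (B : completeNormedModType R).

Lemma markov_powR (Z : T -> R) (r c : R) : 0 < c -> 0 < r ->
  measurable_fun setT Z -> (forall w, 0 <= Z w) ->
  (P [set w | (c < Z w)%R] <= (c `^ (- r))%:E * 'E_P[fun w => (Z w `^ r)%R])%E.
Proof.
move=> c0 r0 mZ Z0.
have mZr : measurable_fun setT (fun w => Z w `^ r).
  by apply: (measurableT_comp (measurable_powR r)).
have mA : measurable [set w | (c < Z w)%R].
  rewrite -[X in measurable X]setTI.
  rewrite (_ : [set w | c < Z w] = [set w | c%:E < (Z w)%:E]%E); last first.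
    by apply/seteqP; split=> w /=; rewrite lte_fin.
  by apply: emeasurable_fun_o_infty => //; exact/measurable_EFinP.
have -> : P [set w | (c < Z w)%R] =
    ((c `^ (- r))%:E * ((c `^ r)%:E * P [set w | (c < Z w)%R]))%E.
  by rewrite muleA -EFinM powRN mulVf ?mul1e// gt_eqF// powR_gt0.
apply: lee_wpmul2l; first by rewrite lee_fin powR_ge0.
rewrite unlock -integral_cst//.
apply: (@le_trans _ _ (\int[P]_(w in [set w | (c < Z w)%R]) (Z w `^ r)%:E)%E).
  apply: ge0_le_integral => //=.
  - by move=> w _; rewrite lee_fin powR_ge0.
  - by apply/measurable_EFinP; exact: measurable_funTS.
  - move=> w /= cZ; rewrite lee_fin.
    by apply: ge0_ler_powR; rewrite ?nnegrE ?Z0// ltW.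
apply: ge0_subset_integral => //; first exact/measurable_EFinP.
by move=> w _; rewrite lee_fin powR_ge0.
Qed.

Lemma weak_moment_le (p C : R) (Z : T -> \bar R) (t : R) : 0 < t ->
  (weak_moment P p Z <= C%:E)%E ->
  (P [set w | (t%:E < Z w)%E] <= (C * t `^ (- p))%:E)%E.
Proof.
move=> t0 ZC; rewrite powRN EFinM lee_pdivlMr ?powR_gt0// muleC.
by apply: le_trans ZC; apply: ereal_sup_ubound; exists t.
Qed.

(** Taking the level [t = s^(1/r)] turns a weak moment of order [p] of the root into one of order
    [p/r] of [V]; the value [+oo] is treated separately. *)
Lemma weak_moment_root_le (p r C : R) (V : T -> \bar R) (s : R) :
  0 < r -> (forall w, 0 <= V w)%E -> 0 < s ->
  (weak_moment P p (fun w => V w `^ (r^-1)%R) <= C%:E)%E ->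
  (P [set w | (s%:E < V w)%E] <= (C * s `^ (- (p / r)))%:E)%E.
Proof.
move=> r0 V0 s0 /(weak_moment_le (powR_gt0 r^-1 s0)).
rewrite -powRrM mulrN [r^-1 * p]mulrC.
suff -> : [set w | (s%:E < V w)%E] = [set w | ((s `^ r^-1)%:E < V w `^ r^-1)%E] by [].
have ri0 : 0 < r^-1 by rewrite invr_gt0.
apply/seteqP; split=> w /=; case: (V w) (V0 w) => [v| |]//=.
- rewrite !lee_fin !lte_fin => v0 sv.
  by apply: gt0_ltr_powR => //; rewrite nnegrE ?ltW.
- by move=> _ _; rewrite gt_eqF// ltry.
- rewrite !lee_fin !lte_fin => v0; apply: contraTT; rewrite -!leNgt => vs.
  by apply: ge0_ler_powR; rewrite ?nnegrE// ltW.
- by move=> _ _; rewrite ltry.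
Qed.

Lemma expectation_indicZ_condexp (G : set (set T)) (A : set T) (X : T -> B)
    (V : T -> \bar R) (r : R) : 0 < r -> measurable A -> G A ->
  is_condexp_ge0 P G (fun w => (`|X w| `^ r)%:E) V ->
  ('E_P[fun w => (`|\1_A w *: X w| `^ r)%R] = \int[P]_(w in A) V w)%E.
Proof.
move=> r0 mA GA [_ _ ->]//; rewrite unlock [RHS]integral_mkcond.
apply: eq_integral => w _; rewrite patchE indicE.
case: (w \in A); first by rewrite scale1r.
(* Off [A] the power is 0 only because [r] is nonzero: [0] to the power [0] is 1. *)
by rewrite scale0r normr0 powR0// gt_eqF.
Qed.

End moments.

(** * The recursive inequality between levels [y] and [y/4] *)

(** The first summand bounds the event that the windowed sum exceeds [y/4], the second the event
    that some increment exceeds [y/2]. The factor [n] in each comes from a bound uniform in the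
    index. *)
Lemma exceeds_recursion (R : realType) (d : measure_display)
    (T : measurableType d) (P : probability T R) (B : completeNormedModType R)
    (r D p1 p2 C1 C2 : R) (F : nat -> set (set T)) (X : nat -> T -> B)
    (V : nat -> T -> \bar R) (n : nat) (y a : R) :
  0 < r -> 0 <= D -> r < p2 ->
  separable_space B -> D_smooth B P r D -> martingale_difference P F X ->
  sigma_subalgebra (F 0%N) -> F 0%N `<=` F 1%N ->
  (forall i, (1 <= i)%N ->
    is_condexp_ge0 P (F i.-1) (fun w => (`|X i w| `^ r)%:E) (V i)) ->
  (forall i, (1 <= i)%N ->
    (weak_moment P p1 (fun w => (`|X i w|%R)%:E) <= C1%:E)%E) ->
  (forall i, (1 <= i)%N ->
    (weak_moment P p2 (fun w => V i w `^ (r^-1)%R) <= C2%:E)%E) ->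
  (1 <= n)%N -> 0 < y -> 0 < a ->
  (P (exceeds X n y) <=
   (D * (y / 4) `^ (- r) * n%:R)%:E * (a%:E * P (exceeds X n (y / 4)) +
     (C2 * (a `^ (1 - p2 / r) / (p2 / r - 1)))%:E)
   + (n%:R * (C1 * (y / 2) `^ (- p1)))%:E)%E.
Proof.
move=> r0 D0 rp2 sepB [_ Dsm] mdX sF0 F01 hV hC1 hC2 n1 y0 a0.
have [sF FF FX X0] := mdX.
have mX i : (1 <= i)%N -> measurable_wrt measurable (X i).
  by move=> /FX[_ []].
have sF' i : sigma_subalgebra (F i) by case: i => [|i] //; exact: sF.
have mE m c : measurable (exceeds X m c).
  apply: exceeds_measurable => //; first exact: sigma_algebra_measurable.
  by move=> i /andP[/mX].
(* Predictability of the window. For [i = 1] it is empty, hence in [F 0]; otherwise it depends only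
   on the first [i - 1] differences. *)
have FW i : (1 <= i)%N -> F i.-1 (window X y i).
  case: i => [|[_|i _]]//=.
    by rewrite window1//; case: (sF' 0%N) => -[].
  have [sFi _] := sF' i.+1.
  have FE c : F i.+1 (exceeds X i.+1 c).
    apply: exceeds_measurable => // j /andP[j1 ji].
    exact: measurable_wrt_sub (FF _ _ j1 ji) (proj1 (FX _ j1)).
  have := FE (y / 4); have := FE y; rewrite -(measurable_g_measurableTypeE sFi).
  by move=> *; exact: measurableD.
have mW i : (1 <= i)%N -> measurable (window X y i).
  by move=> i1; have [_] := sF' i.-1; apply; exact: FW.
pose Y i w := \1_(window X y i) w *: X i w.
have mdY : martingale_difference P F Y.
  apply: martingale_difference_transform => //; first exact/F01/(FW 1%N).
  by move=> i i2; apply: FW; exact: ltnW.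
have mY i : (1 <= i)%N -> measurable_wrt measurable (Y i).
  by have [_ _ FY _] := mdY; move=> /FY[_ []].
have mSY : measurable_fun setT (fun w => `|partial_sum Y n w|).
  apply: measurable_normr_wrt; apply: measurable_wrt_partial_sum => //.
    exact: (sigma_algebra_measurable T).
  by move=> i /andP[/mY].
pose big i := [set w | y / 2 < `|X i.+1 w|].
have mbig i : measurable (big i) by exact: measurable_wrt_norm (mX i.+1 _).
pose far := [set w | y / 4 < `|partial_sum Y n w|].
have mfar : measurable far.
  apply: measurable_wrt_norm; apply: measurable_wrt_partial_sum => //.
    exact: (sigma_algebra_measurable T).
  by move=> i /andP[/mY].
pose J := \big[setU/set0]_(i < n) big i.
have mJ : measurable J by exact: bigsetU_measurable.
have sub : exceeds X n y `<=` far `|` J.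
  move=> w Ey; have [Jw|nJ] := pselect (J w); [by right|left].
  apply: windowed_sum_gt => // -[//|i] /andP[_ ni].
  rewrite leNgt; apply/negP => Xi; apply: nJ.
  by rewrite /J -bigcup_mkord; exists i.
apply: (@le_trans _ _ (P far + P J)%E).
  apply: (le_trans _ (measureU2 _ _ _)) => //.
  by apply: le_measure; rewrite ?inE//; exact: measurableU.
apply: leeD; last first.
  apply: (le_trans (@content_subadditive _ _ _ P _ big n _ _ _)) => //.
  apply: (@le_trans _ _ (\sum_(i < n) (C1 * (y / 2) `^ (- p1))%:E)%E).
    apply: lee_sum => i _.
    have := weak_moment_le _ (hC1 i.+1 _); apply => //.
    by rewrite divr_gt0.
  by rewrite sumEFin lee_fin sumr_const card_ord mulr_natl.
apply: (le_trans (@markov_powR _ _ _ _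
  (fun w => `|partial_sum Y n w|) r (y / 4) _ r0 mSY _)).
- by rewrite divr_gt0.
- by [].
rewrite [D * _]mulrC -mulrA EFinM -muleA; apply: lee_wpmul2l.
  by rewrite lee_fin powR_ge0.
apply: (le_trans (Dsm F Y mdY n n1)).
rewrite EFinM -muleA; apply: lee_wpmul2l; first by rewrite lee_fin.
rewrite big_add1 /= big_mkord.
have q1 : 1 < p2 / r by rewrite ltr_pdivlMr// mul1r.
pose K := (a%:E * P (exceeds X n (y / 4)) +
  (C2 * (a `^ (1 - p2 / r) / (p2 / r - 1)))%:E)%E.
apply: (@le_trans _ _ (\sum_(i < n) K)%E).
  apply: lee_sum => i _.
  rewrite (expectation_indicZ_condexp r0 (mW i.+1 _) (FW i.+1 _) (hV i.+1 _))//.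
  have [V0 mV _] := hV i.+1 (ltn0Sn _).
  have mV' : measurable_fun setT (V i.+1).
    move=> _ A mA; rewrite setTI; have [_] := sF' i; apply; exact: mV.
  (* Each window is contained in one event that does not depend on [i], the exceedance of [y/4] up
     to time [n]. *)
  apply: (@le_trans _ _ (\int[P]_(w in exceeds X n (y / 4)) V i.+1 w)%E).
    apply: ge0_subset_integral => //; first exact: mW.
      exact: measurable_funTS.
    move=> w [[k /= ki yk] _]; exists k => //.
    by apply: leq_trans ki _; apply: ltnW.
  apply: integral_weak_moment_le => // s s0.
  by apply: weak_moment_root_le (hC2 i.+1 _).
suff -> k : (\sum_(i < k) K = k%:R%:E * K)%E by [].
rewrite mule_natl; elim: k => [|k IH]; first by rewrite big_ord0 mule0n.
by rewrite big_ord_recl IH muleS.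
Qed.

(** * Solving the recursion *)

(** [q h] is a supersolution: by the growth condition, the contraction term at [q h] is at most
    [(1 - 1/q) q h = (q - 1) h], and adding [h] restores [q h]. Starting from [f <= 1], after [J]
    iterations the error is [rho^J], which tends to 0. *)
Lemma contraction_bound (R : realType) (f h : R -> R) (q s : R) :
  1 < q -> 1 < s ->
  (forall y : R, 0 < y -> f y <= 1) -> (forall y : R, 0 < y -> 0 <= h y) ->
  (forall y : R, 0 < y -> f y <= (1 - q^-1) / s * f (y / 4) + h y) ->
  (forall y : R, 0 < y -> h (y / 4) <= s * h y) ->
  forall y : R, 0 < y -> f y <= q * h y.
Proof.
move=> q1 s1 f1 h0 fh hs y y0.
pose rho := (1 - q^-1) / s.
have q0 : 0 < q by exact: lt_trans q1.
have s0 : 0 < s by exact: lt_trans s1.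
have iq : 0 < 1 - q^-1 by rewrite subr_gt0 invf_lt1.
have rho0 : 0 < rho by rewrite divr_gt0.
have rho1 : rho < 1.
  by rewrite ltr_pdivrMr// mul1r (lt_trans _ s1)// gtrBl invr_gt0.
have H J z : 0 < z -> f z <= q * h z + rho ^+ J.
  elim: J z => [|J IH] z z0.
    by rewrite expr0 (le_trans (f1 _ z0))// lerDr mulr_ge0 ?h0// ltW.
  have z4 : 0 < z / 4 by rewrite divr_gt0.
  apply: (le_trans (fh _ z0)).
  have : rho * f (z / 4) <= rho * (q * h (z / 4) + rho ^+ J).
    by rewrite ler_pM2l//; exact: IH.
  have : rho * (q * h (z / 4)) <= (q - 1) * h z.
    have -> : q - 1 = rho * q * s by
      rewrite /rho; field; rewrite ?(gt_eqF s0) ?(gt_eqF q0).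
    by rewrite mulrA -[leRHS]mulrA (ler_pM2l (mulr_gt0 rho0 q0)); exact: hs.
  rewrite exprS -/rho; lra.
have cr : rho ^+ J @[J --> \oo] --> 0 by apply: cvg_expr; rewrite gtr0_norm.
rewrite -[leRHS]addr0; apply: ler_cvg_to (cvg_cst (f y)) (cvgD (cvg_cst (q * h y)) cr) _.
by near=> J; exact: H.
Unshelve. all: by end_near. Qed.

(** * The lower bound 1 for the smoothness constant *)

Lemma bochner_integral0 (R : realType) (d : measure_display)
    (T : measurableType d) (P : probability T R) (B : completeNormedModType R) :
  is_bochner_integral P (cst 0 : T -> B) 0.
Proof.
split; first by apply: measurable_wrt_cst; exact: sigma_algebra_measurable.
exists (fun=> cst 0); split.
- move=> _; split.
    apply: (@sub_finite_set _ _ [set (0 : B)]); last exact: finite_set1.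
    by move=> _ [w _ <-].
  by move=> v; rewrite preimage_cst; case: ifP.
- rewrite (_ : (fun m : nat => _) = fun=> 0%E); first exact: cvg_cst.
  apply/funext => m; rewrite (_ : (fun w => _) = (cst 0 : T -> R)).
    by rewrite expectation_cst.
  by apply/funext => w; rewrite /= subr0 normr0.
- rewrite (_ : simple_integral P (cst 0) = 0); first exact: cvg_cst.
  by apply: fsbig1 => _ [w _ <-]; rewrite scaler0.
Qed.

(* The first martingale difference need not be centered, so it can be a
   constant. *)
Lemma D_smooth_ge1 (R : realType) (d : measure_display)
    (T : measurableType d) (P : probability T R) (B : completeNormedModType R)
    (r D : R) (v : B) : v != 0 -> D_smooth B P r D -> 1 <= D.
Proof.
move=> v0 [_ Dsm].
pose F (_ : nat) : set (set T) := measurable.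
pose X i : T -> B := if i == 1%N then cst v else cst 0.
have sT := sigma_algebra_measurable T.
have mX i : measurable_wrt measurable (X i).
  by rewrite /X; case: eqP => _; exact: measurable_wrt_cst.
have X1 i : in_L1 P (X i).
  split; first exact: mX.
  rewrite (_ : (fun w => `|X i w|) = cst `|if i == 1%N then v else 0|).
    by rewrite expectation_cst ltry.
  by apply/funext => w; rewrite /X; case: eqP.
have mdX : martingale_difference P F X.
  split; [by move=> i _; split|by move=> i j _ _ A| |].
    by move=> i _; split; [exact: mX|exact: X1].
  move=> i i2; have Xi : X i = cst 0 by rewrite /X gtn_eqF.
  split; [exact: X1|exact: in_L1_cst0|exact: measurable_wrt_cst|].
  rewrite Xi.
  move=> A _; exists 0.
  rewrite (_ : (fun w => \1_A w *: cst 0 w) = cst 0); last first.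
    by apply/funext => w; rewrite /= scaler0.
  by split; exact: bochner_integral0.
(* At [n = 1] both sides are multiples of the same positive number, the power [r] of the norm of
   [v]. *)
have := Dsm F X mdX 1%N (leqnn _).
rewrite big_nat1.
have -> : (fun w => `|\sum_(1 <= i < 2) X i w| `^ r) = cst (`|v| `^ r).
  by apply/funext => w; rewrite big_nat1.
have -> : (fun w => `|X 1%N w| `^ r) = cst (`|v| `^ r) by [].
rewrite expectation_cst -EFinM lee_fin.
by rewrite -{1}[_ `^ _]mul1r ler_pM2r// powR_gt0// normr_gt0.
Qed.

Lemma weak_moment_ge0 (R : realType) (d : measure_display)
    (T : measurableType d) (P : probability T R) (p C : R) (Z : T -> \bar R) :
  (weak_moment P p Z <= C%:E)%E -> 0 <= C.
Proof.
move=> /(weak_moment_le ltr01); rewrite powR1 mulr1 => ZC.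
by rewrite -lee_fin; exact: le_trans (measure_ge0 P _) ZC.
Qed.

(** * Choice of the truncation level *)

(** Taking [a = rho / E y] gives [f (y/4)] exactly the coefficient [rho] required by
    [contraction_bound]; what remains is the function [h]. *)
Lemma good_lambda_bound (R : realType) (f : R -> R) (D r p1 p2 C1 C2 N : R) :
  0 < D -> 0 < N -> 0 < r -> r < p2 -> p1 <= p2 -> 0 <= C1 -> 0 <= C2 ->
  (forall y : R, 0 < y -> f y <= 1) ->
  (forall y a : R, 0 < y -> 0 < a ->
    f y <= D * (y / 4) `^ (- r) * N *
             (a * f (y / 4) + C2 * (a `^ (1 - p2 / r) / (p2 / r - 1)))
           + N * (C1 * (y / 2) `^ (- p1))) ->
  forall y : R, 0 < y ->
    f y <= p2 / r * (N * (C1 * (y / 2) `^ (- p1)))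
           + C2 * (p2 / (p2 - r)) `^ (p2 / r) * D `^ (p2 / r)
             * 4 `^ (p2 * (p2 / r)) * N `^ (p2 / r) * y `^ (- p2).
Proof.
move=> D0 N0 r0 rp2 p12 C10 C20 f1 fE y y0.
pose q := p2 / r; have q1 : 1 < q by rewrite ltr_pdivlMr// mul1r.
have q0 : 0 < q by exact: lt_trans q1.
have p20 : 0 < p2 by exact: lt_trans rp2.
have rq : r * q = p2 by rewrite mulrC divfK// gt_eqF.
(* The growth factor of [h] under division by 4: its two terms grow by [4^p1] and by
   [(4^r)^q = 4^p2], and [p1 <= p2]. *)
pose s : R := 4 `^ p2.
have s1 : 1 < s.
  by rewrite -(powRr0 4) /s /powR pnatr_eq0/= ltr_expR ltr_pM2r// ln_gt0// ltr1n.
have s0 : 0 < s by exact: lt_trans s1.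
pose rho := (1 - q^-1) / s.
have rho0 : 0 < rho by rewrite divr_gt0// subr_gt0 invf_lt1.
pose E z := D * (z / 4) `^ (- r) * N.
have E0 z : 0 < z -> 0 < E z.
  by move=> z0; rewrite !mulr_gt0// powR_gt0// divr_gt0.
pose h z := N * (C1 * (z / 2) `^ (- p1)) +
  E z `^ q * (C2 * (rho `^ (1 - q) / (q - 1))).
have c0 : 0 <= C2 * (rho `^ (1 - q) / (q - 1)).
  by rewrite !mulr_ge0 ?powR_ge0// invr_ge0 subr_ge0 ltW.
apply: (@le_trans _ _ (q * h y)).
  apply: (contraction_bound q1 s1 f1) => //.
  - move=> z z0; apply: addr_ge0; last exact: mulr_ge0 (powR_ge0 _ _) c0.
    by apply: mulr_ge0; [exact: ltW|rewrite mulr_ge0// powR_ge0].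
  - move=> z z0; have Ez := E0 _ z0.
    have a0 : 0 < rho / E z by rewrite divr_gt0.
    apply: (le_trans (fE z _ z0 a0)); rewrite -/(E z) -/q -/rho.
    rewrite /h [X in _ <= X]addrCA [X in _ <= X]addrC lerD2r.
    rewrite mulrDr mulrA [E z * (rho / E z)]mulrCA divff ?gt_eqF// mulr1 lerD2l.
    (* Multiplied by the prefactor [E z], this leaves [E z] to the power [q], as in [h]. *)
    have -> : (rho / E z) `^ (1 - q) = rho `^ (1 - q) * (E z `^ q / E z).
      rewrite powRM ?ltW ?invr_gt0//; congr (_ * _).
      rewrite -[(E z)^-1]powR_inv1 ?ltW// -powRrM -powRD ?(gt_eqF Ez) ?implybT//.
      by congr (_ `^ _); ring.
    rewrite le_eqVlt; apply/orP; left; apply/eqP.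
    by field; rewrite (gt_eqF Ez) gt_eqF// subr_gt0.
  - move=> z z0; rewrite /h mulrDr.
    have -> : E (z / 4) `^ q = s * E z `^ q.
      have -> : E (z / 4) = 4 `^ r * E z.
        have z4 : z / 4 / 4 = 4^-1 * (z / 4) by ring.
        rewrite /E z4 powRM ?invr_ge0 ?divr_ge0 ?(ltW z0)//.
        rewrite -[4^-1]powR_inv1// -powRrM mulrN mulN1r opprK.
        by ring.
      by rewrite powRM ?powR_ge0 ?ltW ?E0// -powRrM rq.
    rewrite [X in _ <= _ + X]mulrA lerD2r [leRHS]mulrCA ler_pM2l//.
    rewrite [leRHS]mulrCA ler_wpM2l//.
    have -> : z / 4 / 2 = 4^-1 * (z / 2) by field.
    rewrite powRM ?invr_ge0 ?divr_ge0 ?(ltW z0)// ler_wpM2r ?powR_ge0//.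
    rewrite -powR_inv1// -powRrM mulN1r opprK.
    by rewrite ler_powR// ler1n.
rewrite /h mulrDr lerD2l le_eqVlt; apply/orP; left; apply/eqP.
rewrite -/q.
have -> : E y `^ q = D `^ q * (4 `^ p2 * y `^ (- p2)) * N `^ q.
  rewrite /E powRM ?mulr_ge0 ?powR_ge0 ?(ltW D0) ?(ltW N0)//.
  rewrite powRM ?powR_ge0 ?(ltW D0)//; congr (_ * _ * _).
  rewrite -powRrM mulNr rq mulrC powRM ?invr_ge0 ?(ltW y0)//.
  by rewrite -[4^-1]powR_inv1// -powRrM mulN1r opprK.
have qm0 : 0 < q - 1 by rewrite subr_gt0.
(* Here [p2/(p2-r)] is the inverse of [u = (q-1)/q]. The extra factor [u] cancels [q/(q-1)], and
   [1/s] cancels the [4^p2] coming from [E y]. *)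
have -> : rho `^ (1 - q) = (p2 / (p2 - r)) `^ q * ((q - 1) / q) * 4 `^ (p2 * q) / s.
  have -> : p2 / (p2 - r) = ((q - 1) / q)^-1.
    by rewrite /q; field; rewrite (gt_eqF r0) (gt_eqF p20) mulN1r gt_eqF// subr_gt0.
  have u0 : 0 < (q - 1) / q by rewrite divr_gt0.
  have -> : rho = (q - 1) / q * s^-1.
    by rewrite /rho; field; rewrite (gt_eqF s0) (gt_eqF q0).
  move: ((q - 1) / q) u0 => u u0.
  rewrite powRM ?invr_ge0 ?(ltW u0) ?(ltW s0)//.
  rewrite -[u^-1](powR_inv1 (ltW u0)) -[s^-1](powR_inv1 (ltW s0)) -2!powRrM.
  rewrite [4 `^ (p2 * q)]powRrM -/s -mulrA; congr (_ * _).
    rewrite -{3}[u](powRr1 (ltW u0)) -powRD ?(gt_eqF u0) ?implybT//.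
    by congr (_ `^ _); ring.
  rewrite -powRD ?(gt_eqF s0) ?implybT//.
  by congr (_ `^ _); ring.
rewrite -/s; field.
by rewrite (gt_eqF s0) (gt_eqF q0) gt_eqF// subr_gt0.
Qed.

(** * Comparison with the stated constants *)

Lemma geometric_factor_ge1 (R : realType) (p : R) : 0 < p ->
  1 <= 2 `^ (2 * p) / (2 `^ (2 * p) - 1).
Proof.
move=> p0; set t := 2 `^ _; suff t1 : 1 < t.
  by rewrite ler_pdivlMr ?subr_gt0// mul1r lerBlDr lerDl.
by rewrite -(powRr0 2) /t /powR pnatr_eq0/= ltr_expR ltr_pM2r ?mulr_gt0// ln_gt0// ltr1n.
Qed.

(** [q <= 1 + q <= exp q <= 4^q], where [ln 4 >= 1] follows from [ln (1/2) <= -1/2]. *)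
Lemma le_powR4 (R : realType) (q : R) : 0 <= q -> q <= 4 `^ q.
Proof.
move=> q0; have ln4 : 1 <= ln (4 : R).
  have : ln (1 + - (1/2)) <= - (1/2) :> R by apply: le_ln1Dx; lra.
  have -> : 1 + - (1 / 2) = 2^-1 :> R by field.
  rewrite lnV ?posrE// => l2.
  have -> : 4 = 2 * 2 :> R by ring.
  rewrite lnM ?posrE//; lra.
rewrite /powR pnatr_eq0/=; apply: (@le_trans _ _ (expR q)).
  by apply: le_trans (expR_ge1Dx q); rewrite lerDr.
by rewrite ler_expR ler_peMr.
Qed.

(** The term for large increments carries no power of [D], whereas [K1] contains [D^(p1/r)]; this is
    where [1 <= D] enters. The factor [q = p2/r] is absorbed through [q <= 4^q]. *)
Lemma K1_ge (R : realType) (p1 p2 r D : R) :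
  1 < r -> r < p1 -> p1 <= p2 -> 1 <= D ->
  p2 / r * 2 `^ p1 <= K1 p1 p2 r D.
Proof.
move=> r1 rp1 p12 D1.
have r0 : 0 < r by exact: lt_trans r1.
have p10 : 0 < p1 by exact: lt_trans rp1.
have p20 : 0 < p2 by exact: lt_le_trans p12.
pose q := p2 / r; have q1 : 1 <= q by rewrite ler_pdivlMr// mul1r (le_trans _ p12)// ltW.
have q0 : 0 <= q by exact: le_trans q1.
have DD : 1 <= D `^ (p1 / r).
  by rewrite -[leLHS](powRr0 D) ler_powR// divr_ge0// ltW.
rewrite /K1 -[_ * 2 `^ (1 - r) * _]mulrA -powRD ?pnatr_eq0 ?implybT//.
have -> : 1 - r + (p1 + 2 * p1 * p2 / r) = 1 - r + 2 * p1 * q + p1.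
  by rewrite /q; ring.
rewrite powRD ?pnatr_eq0 ?implybT// -/q.
rewrite -[leLHS]mulr1; apply: ler_pM => //.
  by rewrite mulr_ge0 ?powR_ge0.
rewrite -[leLHS]mul1r; apply: ler_pM => //.
- by rewrite mulr_ge0 ?powR_ge0.
- exact: geometric_factor_ge1.
rewrite ler_wpM2r ?powR_ge0//; apply: (le_trans (le_powR4 q0)).
have -> : 4 = 2 `^ 2 :> R by rewrite powR_mulrn//; ring.
rewrite -powRrM ler_powR ?ler1n//.
(* These two products yield the exponent inequality [2q <= 1 - r + 2 p1 q]. *)
have : 0 <= (p1 - r) * q by rewrite mulr_ge0 ?subr_ge0 ?(ltW rp1).
have : 0 <= (r - 1) * (q - 1) by rewrite mulr_ge0 ?subr_ge0 ?(ltW r1).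
nra.
Qed.

(** The power of 4 equals [2^(2 p2^2/r)], and the surplus [2^(1 - r + p2)] in [K2] is at least 1
    since [p2 > r]. *)
Lemma K2_ge (R : realType) (p1 p2 r D : R) :
  0 < r -> r < p2 ->
  (p2 / (p2 - r)) `^ (p2 / r) * D `^ (p2 / r) * 4 `^ (p2 * (p2 / r))
    <= K2 p1 p2 r D.
Proof.
move=> r0 rp2; have p20 : 0 < p2 by exact: lt_trans rp2.
rewrite /K2 -[_ * 2 `^ (1 - r) * _]mulrA -powRD ?pnatr_eq0 ?implybT//.
rewrite [leLHS]mulrC [X in _ * X]mulrC [leLHS]mulrA.
rewrite ler_wpM2r ?powR_ge0// ler_wpM2r ?powR_ge0//.
rewrite -[leLHS]mul1r; apply: ler_pM => //.
  exact: geometric_factor_ge1.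
have -> : 4 = 2 `^ 2 :> R by rewrite powR_mulrn//; ring.
rewrite -powRrM ler_powR ?ler1n//.
have -> : 2 * p2 ^+ 2 / r = 2 * (p2 * (p2 / r)) by rewrite expr2; ring.
lra.
Qed.

(** * The tail bound and its rate of decay *)

Theorem theorem2p4 (R : realType) (d : measure_display) (T : measurableType d)
    (P : probability T R) (B : completeNormedModType R)
    (r D p1 p2 C1 C2 : R)
    (F : nat -> set (set T)) (X : nat -> T -> B) (V : nat -> T -> \bar R)
    (hr : 1 < r) (hr2 : r <= 2) (hD : 0 < D)
    (hB : separable_space B) (hsmooth : D_smooth B P r D)
    (hp1 : r < p1) (hp12 : p1 <= p2)
    (hX : martingale_difference P F X)
    (hF0 : sigma_subalgebra (F 0%N)) (hF01 : F 0%N `<=` F 1%N)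
    (* V i is a version of E[ ||X_i||^r | F_(i-1) ] *)
    (hV : forall i : nat, (1 <= i)%N ->
      is_condexp_ge0 P (F i.-1) (fun w => (`|X i w| `^ r)%:E) (V i))
    (hC1 : (ereal_sup [set weak_moment P p1 (fun w => (`|X i w|%R)%:E)
                      | i in [set i : nat | (1 <= i)%N]] <= C1%:E)%E)
    (hC2 : (ereal_sup [set weak_moment P p2 (fun w => V i w `^ (r^-1)%R)
                      | i in [set i : nat | (1 <= i)%N]] <= C2%:E)%E) :
  (forall (x : R) (n : nat), 0 < x -> (1 <= n)%N ->
    (P [set w | (n%:R * x < max_partial_sum X n w)%R] <=
     (K1 p1 p2 r D * C1 * x `^ (- p1) * (1 / n%:R `^ (p1 - 1))
      + K2 p1 p2 r D * C2 * x `^ (- p2) * (1 / n%:R `^ (p2 - p2 / r)))%R%:E)%E)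
  /\
  (fun n : nat => fine (P [set w | (n%:R < max_partial_sum X n w)%R]) : R)
    =O_\oo (fun n : nat => 1 / n%:R `^ (Num.min (p1 - 1) (p2 - p2 / r)) : R).
Proof.
have r0 : 0 < r by exact: lt_trans hr.
have rp2 : r < p2 by exact: lt_le_trans hp12.
have p20 : 0 < p2 by exact: lt_trans rp2.
have wC1 i : (1 <= i)%N ->
    (weak_moment P p1 (fun w => (`|X i w|%R)%:E) <= C1%:E)%E.
  by move=> i1; apply: le_trans hC1; apply: ereal_sup_ubound; exists i.
have wC2 i : (1 <= i)%N ->
    (weak_moment P p2 (fun w => V i w `^ (r^-1)%R) <= C2%:E)%E.
  by move=> i1; apply: le_trans hC2; apply: ereal_sup_ubound; exists i.
have C10 : 0 <= C1 by exact: weak_moment_ge0 (wC1 1%N (leqnn _)).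
have C20 : 0 <= C2 by exact: weak_moment_ge0 (wC2 1%N (leqnn _)).
have K10 : 0 <= K1 p1 p2 r D.
  do 3!(apply: mulr_ge0; last exact: powR_ge0).
  exact: le_trans ler01 (geometric_factor_ge1 p20).
have K20 : 0 <= K2 p1 p2 r D.
  by apply: le_trans (K2_ge p1 D r0 rp2); rewrite !mulr_ge0 ?powR_ge0.
have mE n y : measurable (exceeds X n y).
  apply: exceeds_measurable => //; first exact: sigma_algebra_measurable.
  by case: hX => _ _ FX _ i /andP[/FX[_ []]].
have tail (x : R) (n : nat) : 0 < x -> (1 <= n)%N ->
    (P [set w | (n%:R * x < max_partial_sum X n w)%R] <=
     (K1 p1 p2 r D * C1 * x `^ (- p1) * (1 / n%:R `^ (p1 - 1))
      + K2 p1 p2 r D * C2 * x `^ (- p2) * (1 / n%:R `^ (p2 - p2 / r)))%R%:E)%E.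
  move=> x0 n1; have n0 : 0 < n%:R :> R by rewrite ltr0n.
  have nx0 : 0 < n%:R * x by exact: mulr_gt0.
  rewrite max_partial_sum_gt ?(ltW nx0)//.
  (* The bound [1 <= D] is obtained from a nonzero vector; in the zero space all partial sums vanish
     and the event is empty. *)
  have [[v v0]|B0] := pselect (exists v : B, v != 0); last first.
    rewrite (_ : exceeds X n _ = set0) ?measure0 ?lee_fin; last first.
      apply/seteqP; split=> w // [k _]; apply: contraTP.
      rewrite (_ : partial_sum X k w = 0) ?normr0 -?leNgt ?ltW//.
      by apply/eqP; apply: contrapT => /negP S0; apply: B0; exists (partial_sum X k w).
    by apply: addr_ge0; rewrite mulr_ge0 ?divr_ge0 ?powR_ge0// mulr_ge0 ?powR_ge0//
      mulr_ge0.
  have D1 : 1 <= D by exact: D_smooth_ge1 v0 hsmooth.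
  pose f y := fine (P (exceeds X n y)).
  have fE y : P (exceeds X n y) = (f y)%:E by rewrite /f fineK// fin_num_measure.
  have f1 y : 0 < y -> f y <= 1 by move=> _; rewrite -lee_fin -fE probability_le1.
  have rec y a : 0 < y -> 0 < a ->
      f y <= D * (y / 4) `^ (- r) * n%:R *
               (a * f (y / 4) + C2 * (a `^ (1 - p2 / r) / (p2 / r - 1)))
             + n%:R * (C1 * (y / 2) `^ (- p1)).
    move=> y0 a0.
    have := exceeds_recursion r0 (ltW hD) rp2 hB hsmooth hX hF0 hF01 hV wC1 wC2
      n1 y0 a0.
    by rewrite !fE -!EFinM -!EFinD.
  rewrite fE lee_fin.
  (* Used with [N = n] at level [y = n x]; what follows sorts the powers of [n] and [x]. *)
  apply: (le_trans (good_lambda_bound hD n0 r0 rp2 hp12 C10 C20 f1 rec nx0)).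
  have powN p : (n%:R * x) `^ (- p) = n%:R `^ (- p) * x `^ (- p).
    by rewrite powRM// ltW.
  have npow p q : 1 / n%:R `^ (p - q) = n%:R `^ (- p) * n%:R `^ q :> R.
    by rewrite div1r -powRN opprB addrC powRD// (gt_eqF n0) implybT.
  apply: lerD.
    rewrite npow powRr1 ?(ltW n0)//.
    have -> : n%:R * x / 2 = 2^-1 * (n%:R * x) by ring.
    rewrite powRM ?(ltW nx0)// powN -[2^-1]powR_inv1// -powRrM mulN1r opprK.
    rewrite [leLHS](_ : _ = p2 / r * 2 `^ p1 *
      (C1 * x `^ (- p1) * (n%:R `^ (- p1) * n%:R))); last by ring.
    rewrite [leRHS](_ : _ = K1 p1 p2 r D *
      (C1 * x `^ (- p1) * (n%:R `^ (- p1) * n%:R))); last by ring.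
    by rewrite ler_wpM2r ?K1_ge// !mulr_ge0 ?powR_ge0.
  rewrite npow powN.
  rewrite [leLHS](_ : _ = (p2 / (p2 - r)) `^ (p2 / r) * D `^ (p2 / r) *
    4 `^ (p2 * (p2 / r)) *
    (C2 * x `^ (- p2) * (n%:R `^ (- p2) * n%:R `^ (p2 / r)))); last by ring.
  rewrite [leRHS](_ : _ = K2 p1 p2 r D *
    (C2 * x `^ (- p2) * (n%:R `^ (- p2) * n%:R `^ (p2 / r)))); last by ring.
  by rewrite ler_wpM2r ?K2_ge// !mulr_ge0 ?powR_ge0.
split => //.
pose m := Num.min (p1 - 1) (p2 - p2 / r).
(* The added 1 makes the constant strictly positive even if [C1] and [C2] are 0. *)
apply/eqO_exP; exists (K1 p1 p2 r D * C1 + K2 p1 p2 r D * C2 + 1).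
  by rewrite ltr_wpDl// addr_ge0// mulr_ge0.
near=> n.
have n1 : (1 <= n)%N by near: n; exact: nbhs_infty_ge.
have n0 : 0 < n%:R :> R by rewrite ltr0n.
rewrite (ger0_norm (fine_ge0 _))// ger0_norm ?divr_ge0 ?powR_ge0//.
(* For [n >= 1] the smaller exponent gives the slower decay, so both terms are bounded by the rate
   with the minimum. *)
have le_m p : m <= p -> 1 / n%:R `^ p <= 1 / n%:R `^ m :> R.
  move=> mp; rewrite !div1r lef_pV2 ?posrE ?powR_gt0//.
  by rewrite ler_powR// ler1n.
have := tail 1 n ltr01 n1; rewrite mulr1 !powR1 !mulr1 => tl.
rewrite -lee_fin fineK; last by rewrite max_partial_sum_gt// fin_num_measure.
apply: (le_trans tl); rewrite lee_fin -/m mulrDl mulrDl.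
rewrite -[leLHS]addr0; apply: lerD; last by rewrite mul1r divr_ge0// powR_ge0.
apply: lerD; apply: ler_wpM2l.
- exact: mulr_ge0.
- by apply: le_m; rewrite /m ge_min lexx.
- exact: mulr_ge0.
- by apply: le_m; rewrite /m ge_min lexx orbT.
Unshelve. all: by end_near. Qed.
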